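(* Let $\Sigma,\Gamma,\Delta$ be finite alphabets with probability distributions $\mu,\nu,o$ having positive Shannon entropy. Let $\delta_1:S\times\Sigma\to S\times\Gamma^*$ and $\delta_2:T\times\Gamma\to T\times\Delta^*$ be productive protocols such that $(S,\delta_1,s)$ is a reduction from $\mu$ to $\nu$ and $(T,\delta_2,t)$ is a reduction from $\nu$ to $o$. If the efficiencies $\mathrm{Eff}(\delta_1)$ and $\mathrm{Eff}(\delta_2)$ exist, then $\mathrm{Eff}(\delta_1\circ\delta_2)$ exists and $\mathrm{Eff}(\delta_1\circ\delta_2)=\mathrm{Eff}(\delta_1)\cdot\mathrm{Eff}(\delta_2)$.
   Context: A protocol $\delta:S\times\Sigma\to S\times\Gamma^*$ is extended to $S\times\Sigma^*$ by $\delta(s,\varepsilon)=(s,\varepsilon)$, $\delta(s,ax)=(u,yz)$ where $(t,y)=\delta(s,a)$, $(u,z)=\delta(t,x)$; $|\delta(s,x)|$ is the length of the output (second component). For $\alpha\in\Sigma^\omega$ with length-$n$ prefix $\alpha_n$, $\delta^\omega(s,\alpha)$ is the infinite word whose prefixes are the prefixes of the outputs of $\delta(s,\alpha_n)$. Sequential composition: $(\delta_1\circ\delta_2)((s,t),a)=((u,v),z)$ where $(u,y)=\delta_1(s,a)$, $(v,z)=\delta_2(t,y)$; it is run from start state $(s,t)$. Input streams have i.i.d. letters with the given law. Productive: from every state, expected number of input letters before an output letter is finite. Reduction from $\mu$ to $\nu$: $\Pr_\alpha(y\text{ prefix of }\delta^\omega(s,\alpha))=\nu(y_1)\cdots\nu(y_{|y|})$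 for all $y\in\Gamma^*$. For a reduction $(S,\delta,s)$ from $\mu$ to $\nu$, define random variables $E_n(\alpha)=\frac{|\delta(s,\alpha_n)|}{n}\cdot\frac{H(\nu)}{H(\mu)}$, where $H$ is Shannon entropy (base 2). The efficiency $\mathrm{Eff}(\delta)$ exists and equals the constant $e$ if $E_n\to e$ in probability, i.e. $\Pr(|E_n-e|>\epsilon)\to0$ for every $\epsilon>0$. *)

(* Defs.v *)
From HB Require Import structures.
From mathcomp Require Import all_boot all_order all_algebra.
From mathcomp Require Import all_classical all_reals all_analysis.
From mathcomp Require Import measurable_realfun.

Set Implicit Arguments.
Unset Strict Implicit.
Unset Printing Implicit Defensive.

Import Order.TTheory GRing.Theory Num.Theory.
Import numFieldTopology.Exports numFieldNormedType.Exports.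

Local Open Scope classical_set_scope.
Local Open Scope ring_scope.

Record fdist (R : realType) (A : finType) := FDist {
  fdist_fun :> A -> R;
  fdist_ge0 : forall a, 0 <= fdist_fun a;
  fdist_sum1 : \sum_a fdist_fun a = 1 }.

(* Shannon entropy in bits; since [ln 0 = 0], letters of probability 0
   contribute 0. *)
Definition entropy (R : realType) (A : finType) (mu : fdist R A) : R :=
  - \sum_a mu a * (ln (mu a) / ln 2).

(* Infinite words over [A].  The distribution [mu] is a phantom argument: it
   witnesses that [A] is inhabited, as a pointed type is needed below. *)
Definition stream (R : realType) (A : finType) (mu : fdist R A) : Type :=
  nat -> A.

Section streams.
Context (R : realType) (A : finType) (mu : fdist R A).

Lemma fdist_inhabited : inhabited A.
Proof.
have [|A0] := pselect (exists a : A, True); first by case=> a _.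
have := fdist_sum1 mu; rewrite big1 => [/eqP|a _].
  by rewrite eq_sym oner_eq0.
by case: A0; exists a.
Qed.

Definition fdist_point : A := proj1_sig (cid (let: inhabits a := fdist_inhabited
  in ex_intro (fun _ : A => True) a I)).

HB.instance Definition _ := Choice.copy (stream mu) (nat -> A).
HB.instance Definition _ := isPointed.Build (stream mu) (fun=> fdist_point).

Definition cylinder (w : seq A) : set (stream mu) :=
  [set alpha | mkseq alpha (size w) = w].

(* Infinite words with the sigma-algebra generated by the cylinders. *)
Definition streamM := g_sigma_algebraType (range cylinder).

(* The law of an i.i.d. sequence of letters is obtained as the image of the
   Lebesgue measure on [0, 1[ by the map that subdivides the current interval
   proportionally to [mu] at each letter. *)

Let c (a : A) : R := \sum_(b | (enum_rank b < enum_rank a)%N) mu b.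
Let F (k : nat) : R := \sum_(b | (enum_rank b < k)%N) mu b.

Let FS (a : A) : F (enum_rank a).+1 = c a + mu a.
Proof.
rewrite /F (bigD1 a)//= addrC; congr (_ + _); apply: eq_bigl => b.
rewrite ltnS leq_eqVlt; case: (eqVneq b a) => [->|ba]; first by rewrite ltnn andbF.
by rewrite andbT -(inj_eq enum_rank_inj) -val_eqE /= in ba *; rewrite (negbTE ba).
Qed.

Let F_homo m n : (m <= n)%N -> F m <= F n.
Proof.
move=> mn; rewrite /F [leLHS]big_mkcond [leRHS]big_mkcond /=.
apply: ler_sum => b _; case: ifPn => bm; last by case: ifP => // _; exact: fdist_ge0.
by rewrite (leq_trans bm mn).
Qed.

Let F1 : F #|A| = 1.
Proof. by rewrite -(fdist_sum1 mu); apply: eq_bigl => b; rewrite ltn_ord. Qed.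

Let c_ge0 a : 0 <= c a. Proof. by apply: sumr_ge0 => *; exact: fdist_ge0. Qed.

Let c_le1 a : c a + mu a <= 1.
Proof. by rewrite -FS -F1; apply: F_homo; exact: ltn_ord. Qed.

Let inI a x := (c a <= x < c a + mu a).

Let inI_ex x : 0 <= x < 1 -> exists a, inI a x.
Proof.
move=> /andP[x0 x1].
have ex : exists k, x < F k by exists #|A|; rewrite F1.
case: (ex_minnP ex) => -[|k] xk kmin.
  by move: xk; rewrite /F big_pred0 ?ltNge ?x0.
have kA : (k < #|A|)%N by apply: kmin; rewrite F1.
pose a := enum_val (Ordinal kA); exists a.
have ka : k = enum_rank a by rewrite enum_valK.
rewrite /inI -FS -ka xk andbT /c -ka leNgt; apply/negP => xFk.
by have := kmin _ xFk; rewrite ltnn.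
Qed.

Let inI_inj a b x : inI a x -> inI b x -> a = b.
Proof.
move=> /andP[ax xa] /andP[bx xb].
have key a' b' : c b' <= x -> x < c a' + mu a' ->
    (enum_rank b' <= enum_rank a')%N.
  move=> bx' xa'; rewrite leqNgt; apply/negP => ab.
  have : c a' + mu a' <= c b' by rewrite -FS; exact: F_homo.
  by rewrite leNgt (le_lt_trans bx' xa').
by apply/enum_rank_inj/val_inj/eqP; rewrite eqn_leq !key.
Qed.

Let letter x : A := odflt fdist_point [pick a | inI a x].
Let shift x : R := (x - c (letter x)) / mu (letter x).
Let digits x : stream mu := fun n => letter (iter n shift x).

Let letterP x : 0 <= x < 1 -> inI (letter x) x.
Proof.
move=> /inI_ex[a ax]; rewrite /letter; case: pickP => [b //|/(_ a)].
by rewrite ax.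
Qed.

Let pr (w : seq A) : R := \prod_(a <- w) mu a.
Fixpoint stream_low (w : seq A) : R :=
  if w is a :: w' then c a + mu a * stream_low w' else 0.
Let lo := stream_low.

Let pr_ge0 w : 0 <= pr w.
Proof. by apply: prodr_ge0 => *; exact: fdist_ge0. Qed.

Let lo_bound w : 0 <= lo w /\ lo w + pr w <= 1.
Proof.
elim: w => [|a w [l0 l1]]; first by rewrite /lo /pr /= big_nil add0r.
rewrite /lo /pr /= big_cons -/(pr w) -/(lo w); split.
  by rewrite addr_ge0// mulr_ge0// fdist_ge0.
rewrite -addrA -mulrDr (le_trans _ (c_le1 a))// lerD2l.
by rewrite ler_piMr// fdist_ge0.
Qed.

Let digitsP w x : 0 <= x < 1 ->
  (mkseq (digits x) (size w) = w) <-> (lo w <= x < lo w + pr w).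
Proof.
elim: w x => [|a w IH] x x01.
  by rewrite /lo /pr /= big_nil add0r x01.
have lx := letterP x01.
have mu0 : 0 < mu (letter x).
  case/andP: lx => l1 l2; have := le_lt_trans l1 l2.
  by rewrite -subr_gt0 addrAC subrr add0r.
have s01 : 0 <= shift x < 1.
  case/andP: lx => l1 l2.
  rewrite /shift ler_pdivlMr// mul0r subr_ge0 l1 ltr_pdivrMr// mul1r.
  by rewrite ltrBlDl.
have -> : mkseq (digits x) (size (a :: w)) =
    letter x :: mkseq (digits (shift x)) (size w).
  rewrite /mkseq /= -[1%N]addn0 iotaDl -map_comp; congr (_ :: _).
  by apply: eq_map => n /=; rewrite /digits add1n iterSr.
have H : (lo (a :: w) <= x < lo (a :: w) + pr (a :: w)) ->
   letter x = a.
  have [l0 l1] := lo_bound w.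
  rewrite /lo /pr /= big_cons -/(pr w) -/(lo w) => /andP[h1 h2].
  apply: (inI_inj lx); rewrite /inI; apply/andP; split.
    by rewrite (le_trans _ h1)// lerDl mulr_ge0// fdist_ge0.
  rewrite (lt_le_trans h2)// -addrA -mulrDr lerD2l.
  by rewrite ler_piMr// fdist_ge0.
have E : (lo (letter x :: w) <= x < lo (letter x :: w) + pr (letter x :: w)) =
   (lo w <= shift x < lo w + pr w).
  rewrite /lo /pr /= big_cons -/(pr w) -/(lo w).
  rewrite /shift ler_pdivlMr// ltr_pdivrMr// lerBrDl ltrBlDl.
  by rewrite ![_ * mu _]mulrC mulrDr addrA.
split=> [[la ww]|xw].
  by rewrite -la E; apply/IH.
have la := H xw; rewrite la; congr (_ :: _).
by apply/IH => //; rewrite -E la.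
Qed.

Let clamp (x : R) : R := if 0 <= x < 1 then x else 0.
Let X (x : measurableTypeR R) : streamM := digits (clamp x).

Let clamp01 x : 0 <= clamp x < 1.
Proof. by rewrite /clamp; case: ifP => // _; rewrite lexx ltr01. Qed.

Let X_cylinder w : X @^-1` (cylinder w) = clamp @^-1` `[lo w, lo w + pr w[.
Proof.
apply/seteqP; split=> x /=; rewrite /cylinder/= /X in_itv/=.
  by move/(digitsP _ (clamp01 _)).
by move=> h; apply/(digitsP _ (clamp01 _)).
Qed.

Let measurable_clamp : measurable_fun [set: measurableTypeR R] clamp.
Proof.
apply: measurable_fun_if => //=.
by apply: measurable_and; [exact: measurable_fun_ler|exact: measurable_fun_ltr].
Qed.

Let measurable_X : measurable_fun [set: measurableTypeR R] X.
Proof.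
apply: (@measurability _ _ _ _ _ X (range cylinder)) => //.
move=> _ [_ [w _ <-] <-]; rewrite X_cylinder.
exact: measurable_clamp.
Qed.

HB.instance Definition _ := isMeasurableFun.Build _ _ _ _ X measurable_X.

Let unitI : measurable (`[0, 1[%classic : set (measurableTypeR R)).
Proof. exact: measurable_itv. Qed.
Definition unit_lebesgue := mrestr (@lebesgue_measure R) unitI.

HB.instance Definition _ := Measure.on unit_lebesgue.

Let unit_lebesgue1 : unit_lebesgue setT = 1%E.
Proof.
rewrite /unit_lebesgue /mrestr setTI [LHS]lebesgue_measure_itv/= lte_fin ltr01.
by rewrite -EFinD subr0.
Qed.

HB.instance Definition _ :=
  Measure_isProbability.Build _ _ _ unit_lebesgue unit_lebesgue1.

Lemma iid_prob_exists : exists P : probability streamM R,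
  forall w : seq A, P (cylinder w) = (\prod_(a <- w) mu a)%:E.
Proof.
exists (distribution unit_lebesgue X) => w.
rewrite -[LHS]/(lebesgue_measure (X @^-1` cylinder w `&` `[0, 1[%classic)).
rewrite X_cylinder.
have -> : clamp @^-1` `[lo w, lo w + pr w[ `&` `[0, 1[ =
    `[lo w, lo w + pr w[%classic.
  have [l0 l1] := lo_bound w.
  apply/seteqP; split=> x /=; rewrite !in_itv/= /clamp.
    by move=> [+ x01]; rewrite x01.
  move=> /andP[h1 h2].
  have -> : 0 <= x < 1 by rewrite (le_trans l0 h1) (lt_le_trans h2 l1).
  by rewrite h1 h2.
rewrite [LHS]lebesgue_measure_itv/= lte_fin ltrDl.
have := pr_ge0 w; rewrite le_eqVlt => /orP[/eqP p0|p0].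
  by rewrite -p0 ltxx -/(pr w) -p0.
by rewrite p0 -EFinD addrAC subrr add0r.
Qed.

(* The product measure: the unique probability that gives each cylinder the
   product of the probabilities of its letters. *)
Definition iid_prob : probability streamM R := proj1_sig (cid iid_prob_exists).

Lemma iid_probE (w : seq A) : iid_prob (cylinder w) = (\prod_(a <- w) mu a)%:E.
Proof. exact: (proj2_sig (cid iid_prob_exists)). Qed.

End streams.

Definition protocol (S A B : Type) := S -> A -> S * seq B.

Fixpoint run (S A B : Type) (delta : protocol S A B) (s : S) (x : seq A) :
    S * seq B :=
  if x is a :: x' then
    let: (t, y) := delta s a in
    let: (u, z) := run delta t x' in (u, y ++ z)
  else (s, [::]).

Definition output (S A B : Type) (delta : protocol S A B) (s : S)
  (alpha : nat -> A) (n : nat) : seq B := (run delta s (mkseq alpha n)).2.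

Definition protocol_comp (S T A B C : Type) (delta1 : protocol S A B)
    (delta2 : protocol T B C) : protocol (S * T) A C :=
  fun st a =>
    let: (s, t) := st in
    let: (u, y) := delta1 s a in
    let: (v, z) := run delta2 t y in ((u, v), z).

(* [+oo] if no letter is ever output. *)
Definition output_time (R : realType) (S A B : Type) (delta : protocol S A B)
    (s : S) (alpha : nat -> A) : \bar R :=
  ereal_inf [set n%:R%:E | n in [set n | (0 < size (output delta s alpha n))%N]].

Definition productive (R : realType) (A : finType) (mu : fdist R A)
    (S B : Type) (delta : protocol S A B) : Prop :=
  forall s : S, (\int[iid_prob mu]_alpha output_time R delta s alpha < +oo)%E.

(* [y] is a prefix of the (possibly finite) limit of the outputs on the finite
   prefixes of [alpha]. *)
Definition omega_prefix (S A : Type) (B : eqType) (delta : protocol S A B)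
    (s : S) (alpha : nat -> A) (y : seq B) : Prop :=
  exists n, prefix y (output delta s alpha n).

Definition reduction (R : realType) (A B : finType) (mu : fdist R A)
    (nu : fdist R B) (S : Type) (delta : protocol S A B) (s : S) : Prop :=
  forall y : seq B,
    iid_prob mu [set alpha | omega_prefix delta s alpha y]
      = (\prod_(b <- y) nu b)%:E.

Definition eff_ratio (R : realType) (A B : finType) (mu : fdist R A)
    (nu : fdist R B) (S : Type) (delta : protocol S A B) (s : S) (n : nat)
    (alpha : nat -> A) : R :=
  (size (output delta s alpha n))%:R / n%:R * (entropy nu / entropy mu).

(* The efficiency exists and equals [e]: convergence in probability. *)
Definition has_efficiency (R : realType) (A B : finType) (mu : fdist R A)
    (nu : fdist R B) (S : Type) (delta : protocol S A B) (s : S) (e : R) :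
    Prop :=
  forall eps : R, 0 < eps ->
    (fun n : nat =>
       iid_prob mu [set alpha | eps < `|eff_ratio mu nu delta s n alpha - e|])
      @ \oo --> 0%E.

(* Main.v *)
(* Let [beta] be the output stream of [delta1]; by the reduction hypothesis it is
   i.i.d. with law [nu].  After [n] input letters [delta1] has output a prefix
   of [beta] of length about [n * e1 * H(mu) / H(nu)], so with high probability
   this length lies between two deterministic lengths [lo n] and [hi n], both
   linear in [n].  The number of letters that [delta2] outputs is monotone in its
   input, hence lies between its values on the prefixes of [beta] of lengths
   [lo n] and [hi n], which the efficiency of [delta2] controls because these
   lengths are not random.  [beta] itself is never built: only the finitely many
   events that a given word of fixed length is a prefix of it are used. *)
Require Import Defs.
From mathcomp Require Import all_boot all_order all_algebra.
From mathcomp Require Import all_classical all_reals all_analysis.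
From mathcomp Require Import ring lra.

Set Implicit Arguments.
Unset Strict Implicit.
Unset Printing Implicit Defensive.

Import Order.TTheory GRing.Theory Num.Theory.

Local Open Scope classical_set_scope.
Local Open Scope ring_scope.

(** * Runs on concatenated inputs and runs of composed protocols *)

Lemma run_cat (S A B : Type) (delta : protocol S A B) s x y :
  run delta s (x ++ y) =
    ((run delta (run delta s x).1 y).1,
     (run delta s x).2 ++ (run delta (run delta s x).1 y).2).
Proof.
elim: x s => [|a x IH] s /=; first by case: (run delta s y).
case: (delta s a) => t z; rewrite IH.
by case: (run delta t x) => u z' /=; rewrite catA.
Qed.

Lemma prefix_run (S A : Type) (B : eqType) (delta : protocol S A B) s x y :
  prefix (run delta s x).2 (run delta s (x ++ y)).2.
Proof. by rewrite run_cat prefix_prefix. Qed.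

Lemma size_run_prefix (S : Type) (A : eqType) (B : Type)
    (delta : protocol S A B) s (x y : seq A) :
  prefix x y -> (size (run delta s x).2 <= size (run delta s y).2)%N.
Proof. by move=> /prefixP[z ->]; rewrite run_cat size_cat leq_addr. Qed.

(** By [run_cat], feeding [delta2] block by block agrees with feeding it the concatenation of the
    blocks. *)
Lemma run_comp (S T A B C : Type) (delta1 : protocol S A B)
    (delta2 : protocol T B C) s t x :
  (run (protocol_comp delta1 delta2) (s, t) x).2 =
    (run delta2 t (run delta1 s x).2).2.
Proof.
elim: x s t => [//|a x IH] s t /=.
case: (delta1 s a) => u y /=.
case E2: (run delta2 t y) => [v z].
case E3: (run _ (u, v) x) => [p q].
case E4: (run delta1 u x) => [p' q'] /=.
by rewrite run_cat /= E2 /=; congr (_ ++ _); rewrite -[q']/(p', q').2 -E4 -IH E3.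
Qed.

Lemma prefix_output (S A : Type) (B : eqType) (delta : protocol S A B) s
    (alpha : nat -> A) m n :
  (m <= n)%N -> prefix (output delta s alpha m) (output delta s alpha n).
Proof.
move=> /subnKC <-; rewrite /output /mkseq iotaD map_cat.
exact: prefix_run.
Qed.

(** Both words are prefixes of the output at the later of the two times. Hence the events for
    distinct words of one length are disjoint. *)
Lemma omega_prefix_inj (S A : Type) (B : eqType) (delta : protocol S A B) s
    (alpha : nat -> A) (v w : seq B) :
  size v = size w ->
  omega_prefix delta s alpha v -> omega_prefix delta s alpha w -> v = w.
Proof.
move=> vw [m vm] [n wn].
have vN := prefix_trans vm (prefix_output delta s alpha (leq_maxl m n)).
have wN := prefix_trans wn (prefix_output delta s alpha (leq_maxr m n)).
by move: vN wN; rewrite !prefixE vw => /eqP <- /eqP.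
Qed.

(** * Events determined by finitely many letters *)

Lemma finite_words (A : finType) k : finite_set [set w : seq A | size w = k].
Proof.
apply: (sub_finite_set (B := [set val x | x in [set: k.-tuple A]])).
  by move=> w /= wk; exists (Tuple (introT eqP wk)).
by apply: finite_image; exact: finite_finset.
Qed.

Section streams.
Context (R : realType) (A : finType) (mu : fdist R A).

Lemma measurable_cylinder w : measurable (cylinder w : set (streamM mu)).
Proof. by apply: sub_sigma_algebra; exists w. Qed.

Lemma mkseq_preimage (Q : set (seq A)) k :
  [set alpha : streamM mu | Q (mkseq alpha k)] =
  \bigcup_(w in [set w | size w = k /\ Q w]) cylinder w.
Proof.
apply/seteqP; split=> alpha /=.
  by move=> Qa; exists (mkseq alpha k); rewrite /cylinder/= size_mkseq.
by move=> [w /= [<- Qw]]; rewrite /cylinder /= => ->.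
Qed.

Lemma finite_words_cond (Q : set (seq A)) k :
  finite_set [set w : seq A | size w = k /\ Q w].
Proof. by apply: sub_finite_set (finite_words A k) => w []. Qed.

(** The output after [n] letters depends only on the first [n] letters of the input, so events about
    it are measurable by this lemma. *)
Lemma measurable_mkseq (Q : set (seq A)) k :
  measurable [set alpha : streamM mu | Q (mkseq alpha k)].
Proof.
rewrite mkseq_preimage; apply: fin_bigcup_measurable.
  exact: finite_words_cond.
by move=> w _; exact: measurable_cylinder.
Qed.

End streams.

(** * Law of the output prefixes of a reduction *)

Section reduction.
Context (R : realType) (A B : finType) (mu : fdist R A) (nu : fdist R B).
Context (S : Type) (delta : protocol S A B) (s : S).

Lemma measurable_omega_prefix w :
  measurable [set alpha : streamM mu | omega_prefix delta s alpha w].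
Proof.
rewrite (_ : mkset _ = \bigcup_n [set alpha : streamM mu |
  [set x | prefix w (run delta s x).2] (mkseq alpha n)]).
  by apply: bigcup_measurable => n _; exact: measurable_mkseq.
by apply/seteqP; split=> alpha [n] => [wn|_ wn]; exists n.
Qed.

(** The existential replaces the length-[k] prefix of the limit output, which does not exist when
    that output is too short. *)
Definition output_word (Q : set (seq B)) k : set (streamM mu) :=
  [set alpha | exists w, [/\ size w = k, Q w & omega_prefix delta s alpha w]].

Lemma output_wordE Q k : output_word Q k =
  \bigcup_(w in [set w | size w = k /\ Q w])
    [set alpha | omega_prefix delta s alpha w].
Proof.
apply/seteqP; split=> alpha /=; first by move=> [w [? ? ?]]; exists w.
by move=> [w /= [? ?] ?]; exists w.
Qed.

Lemma measurable_output_word Q k : measurable (output_word Q k).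
Proof.
rewrite output_wordE; apply: fin_bigcup_measurable.
  exact: finite_words_cond.
by move=> w _; exact: measurable_omega_prefix.
Qed.

Hypothesis red : reduction mu nu delta s.

(** Both events split into disjoint pieces indexed by the same finite set of words, and [red]
    equates the pieces one by one. *)
Lemma reduction_output_word Q k : iid_prob mu (output_word Q k) =
  iid_prob nu [set beta | Q (mkseq beta k)].
Proof.
rewrite output_wordE (mkseq_preimage nu) !measure_fin_bigcup//.
- apply: eq_fsbigr => w _.
  exact: etrans (red w) (esym (iid_probE nu w)).
- exact: finite_words_cond.
- move=> v w /= [vk _] [wk _] [beta []]; rewrite /cylinder/=.
  by rewrite vk wk => -> ->.
- by move=> w _; exact: measurable_cylinder.
- exact: finite_words_cond.
- move=> v w /= [vk _] [wk _] [beta [/= ov ow]].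
  by apply: omega_prefix_inj ov ow; rewrite vk wk.
- by move=> w _; exact: measurable_omega_prefix.
Qed.

Lemma reduction_output_wordT k : iid_prob mu (output_word setT k) = 1%E.
Proof.
by rewrite reduction_output_word -[RHS](probability_setT (iid_prob nu)).
Qed.

Lemma omega_prefix_take k n alpha : (k <= size (output delta s alpha n))%N ->
  size (take k (output delta s alpha n)) = k /\
  omega_prefix delta s alpha (take k (output delta s alpha n)).
Proof.
by move=> kn; rewrite size_takel//; split=> //; exists n; exact: prefix_take.
Qed.

(** Cutting the output down to [k] letters preserves [Q] and leaves a word of fixed length, whose
    law is known. *)
Lemma output_ge_prob (Q : set (seq B)) k n :
  (forall x y, prefix x y -> Q y -> Q x) ->
  (iid_prob mu [set alpha | (k <= size (output delta s alpha n))%N /\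
                            Q (output delta s alpha n)] <=
   iid_prob nu [set beta | Q (mkseq beta k)])%E.
Proof.
move=> Qle; rewrite -reduction_output_word; apply: le_measure.
- rewrite inE; exact: (@measurable_mkseq R A mu (fun x =>
    (k <= size (run delta s x).2)%N /\ Q (run delta s x).2) n).
- by rewrite inE; exact: measurable_output_word.
move=> alpha /= [kn Qn]; have [sk ok] := omega_prefix_take kn.
exists (take k (output delta s alpha n)); split=> //.
exact: Qle (prefix_take _ _) Qn.
Qed.

(* Almost surely the output eventually reaches length [k], so an output of
   length at most [k] has an extension of length exactly [k] that is output
   later. *)
Lemma output_le_prob (Q : set (seq B)) k n :
  (forall x y, prefix x y -> Q x -> Q y) ->
  (iid_prob mu [set alpha | (size (output delta s alpha n) <= k)%N /\
                            Q (output delta s alpha n)] <=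
   iid_prob nu [set beta | Q (mkseq beta k)])%E.
Proof.
move=> Qle; rewrite -reduction_output_word.
have mT := measurableC (measurable_output_word setT k).
have T0 : iid_prob mu (~` output_word setT k) = 0%E.
  rewrite probability_setC; last exact: measurable_output_word.
  by rewrite reduction_output_wordT subee.
(* The null event that length [k] is never reached is added on the right, so that the inclusion
   below holds everywhere. *)
rewrite -[leRHS]adde0 -T0.
apply: le_trans (measureU2 _ (measurable_output_word _ _) mT).
apply: le_measure.
- rewrite inE; exact: (@measurable_mkseq R A mu (fun x =>
    (size (run delta s x).2 <= k)%N /\ Q (run delta s x).2) n).
- by rewrite inE; apply: measurableU => //; exact: measurable_output_word.
move=> alpha /= [nk Qn].
have [[w [wk _ ow]]|?] := pselect (output_word setT k alpha); last by right.
left; exists w; split=> //; apply: (Qle _ _ _ Qn).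
case: ow => m wm.
have wN := prefix_trans wm (prefix_output delta s alpha (leq_maxl m n)).
have nN := prefix_output delta s alpha (leq_maxr m n).
(* Both words are prefixes of one later output, so the shorter is a prefix of the longer. *)
move: wN nN; rewrite !prefixE wk => /eqP <- /eqP {2}<-.
by rewrite take_takel.
Qed.

End reduction.

(** * Sign and measurability of efficiency ratios *)

Lemma eff_ratio_ge0 (R : realType) (A B : finType) (mu : fdist R A)
    (nu : fdist R B) (S : Type) (delta : protocol S A B) s n alpha :
  0 < entropy mu -> 0 < entropy nu -> 0 <= eff_ratio mu nu delta s n alpha.
Proof. by move=> ? ?; rewrite /eff_ratio !mulr_ge0 ?invr_ge0 ?ler0n// ltW. Qed.

Lemma measurable_eff_ratio (R : realType) (A B : finType) (mu : fdist R A)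
    (nu : fdist R B) (S : Type) (delta : protocol S A B) s n (Q : set R) :
  measurable [set alpha : streamM mu | Q (eff_ratio mu nu delta s n alpha)].
Proof.
exact: (@measurable_mkseq R A mu (fun x => Q ((size (run delta s x).2)%:R / n%:R *
  (entropy nu / entropy mu))) n).
Qed.

(** If [e] were negative, every ratio, being nonnegative, would be farther than [- e / 2] from [e];
    the deviation probability would then be constantly 1. *)
Lemma has_efficiency_ge0 (R : realType) (A B : finType) (mu : fdist R A)
    (nu : fdist R B) (S : Type) (delta : protocol S A B) s e :
  0 < entropy mu -> 0 < entropy nu -> has_efficiency mu nu delta s e -> 0 <= e.
Proof.
move=> Hmu Hnu eff; rewrite leNgt; apply/negP => e0.
have /eff : 0 < - e / 2 by lra.
rewrite (_ : (fun n : nat => _) = cst 1%E) => [/cvg_lim|].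
  rewrite lim_cst// => /(_ (@ereal_hausdorff _)) /eqP.
  by rewrite onee_eq0.
apply/funext => n; rewrite /= -(probability_setT (iid_prob mu)).
congr (iid_prob mu _); apply/seteqP; split=> // alpha _ /=.
have := eff_ratio_ge0 delta s n alpha Hmu Hnu.
by move=> x0; rewrite ger0_norm; lra.
Qed.

(** * Deterministic estimates *)

Lemma linear_growth_cvgny (R : realType) (c : R) (k : nat -> nat) :
  0 < c -> (forall n, c * n%:R <= (k n).+1%:R) -> k n @[n --> \oo] --> \oo.
Proof.
move=> c0 ck; apply/cvgnyPge => M.
near=> n.
rewrite -ltnS -(ltr_nat R); apply: lt_le_trans (ck n).
rewrite -ltr_pdivrMl//.
near: n; exact: nbhs_infty_gtr.
Unshelve. all: by end_near. Qed.

(** Here [n] is the input length, [x] and [y] are the output lengths of [delta1] and of the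
    composition. A deviation of the composite ratio becomes a deviation of the second ratio at a
    fixed length. The condition on [d] comes from [(e2 + d) * (e1 + 2 * d) <= e1 * e2 + d * (e1 + 2
    * e2 + 2)], where [d <= 1] is used. *)
Lemma efficiency_window (R : realFieldType) (h1 h2 e1 e2 d eps n x y hi lo : R) :
  0 < h1 -> 0 < h2 -> 0 <= e1 -> 0 <= e2 -> 0 < d -> d <= 1 ->
  d * (e1 + 2 * e2 + 2) <= eps -> 0 < n -> h1 <= d * n ->
  0 <= y -> 0 < hi ->
  (e1 + d) * n <= hi * h1 -> hi * h1 <= (e1 + 2 * d) * n ->
  (0 < e1 -> [/\ 0 < e1 - 2 * d, lo * h1 <= (e1 - d) * n &
     (e1 - 2 * d) * n <= lo * h1]) ->
  `|x / n * h1 - e1| <= d -> eps < `|y / n * (h1 * h2) - e1 * e2| ->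
  (x <= hi /\ e2 + d < y / hi * h2) \/ (lo <= x /\ y / lo * h2 < e2 - d).
Proof.
move=> h10 h20 e10 e20 d0 d1 deps n0 h1dn y0 hi0 hi1 hi2 lo12.
rewrite ler_norml => /andP[xl xr]; rewrite lter_normr => /orP[yE|yE].
- left; split.
    rewrite -(ler_pM2r h10) (le_trans _ hi1)// -ler_pdivrMr//.
    by rewrite mulrAC; lra.
  rewrite mulrAC ltr_pdivlMr// -(ltr_pM2r h10).
  have : (e1 * e2 + eps) * n < y * (h1 * h2).
    by rewrite -ltr_pdivlMr// mulrAC; lra.
  rewrite (_ : y * h2 * h1 = y * (h1 * h2)); last by ring.
  apply: le_lt_trans; rewrite -mulrA.
  apply: (@le_trans _ _ ((e2 + d) * ((e1 + 2 * d) * n))).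
    by rewrite ler_pM2l//; lra.
  by rewrite mulrA ler_pM2r//; nra.
(* As [y] is nonnegative, a deviation downwards forces [e1 * e2 > eps], hence [e1 > 0], which gives
   access to the bounds on [lo], and [e2 > d]. *)
- have yn : y * (h1 * h2) < (e1 * e2 - eps) * n.
    by rewrite -ltr_pdivrMr// mulrAC; lra.
  have yn0 : 0 < (e1 * e2 - eps) * n.
    by apply: le_lt_trans yn; rewrite !mulr_ge0// ltW.
  have ee0 : 0 < e1 * e2 - eps by rewrite -(pmulr_lgt0 _ n0).
  have e1_gt0 : 0 < e1.
    rewrite lt_neqAle e10 andbT; apply/eqP => e1E.
    by move: ee0; rewrite -e1E mul0r; nra.
  have [ed lo1 lo2] := lo12 e1_gt0.
  have lo0 : 0 < lo.
    by rewrite -(pmulr_lgt0 _ h10); apply: lt_le_trans lo2; rewrite mulr_gt0.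
  have e2d : 0 < e2 - d by rewrite -(pmulr_lgt0 _ e1_gt0); nra.
  right; split.
    rewrite -(ler_pM2r h10) (le_trans lo1)// -ler_pdivlMr//.
    by rewrite mulrAC; lra.
  rewrite mulrAC ltr_pdivrMr// -(ltr_pM2r h10).
  rewrite (_ : y * h2 * h1 = y * (h1 * h2)); last by ring.
  apply: (lt_le_trans yn); rewrite -mulrA.
  apply: (@le_trans _ _ ((e2 - d) * ((e1 - 2 * d) * n))).
    by rewrite mulrA ler_pM2r//; nra.
  by rewrite ler_pM2l.
Qed.

(** * Efficiency of the composition *)

Theorem theorem2 (R : realType) (Sigma Gamma Delta : finType)
    (mu : fdist R Sigma) (nu : fdist R Gamma) (o : fdist R Delta)
    (S T : Type) (delta1 : protocol S Sigma Gamma)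
    (delta2 : protocol T Gamma Delta) (s : S) (t : T) :
  0 < entropy mu -> 0 < entropy nu -> 0 < entropy o ->
  productive mu delta1 -> productive nu delta2 ->
  reduction mu nu delta1 s -> reduction nu o delta2 t ->
  forall e1 e2 : R,
    has_efficiency mu nu delta1 s e1 ->
    has_efficiency nu o delta2 t e2 ->
    has_efficiency mu o (protocol_comp delta1 delta2) (s, t) (e1 * e2).
Proof.
move=> Hmu Hnu Ho _ _ red1 _ e1 e2 eff1 eff2 eps eps0.
have e10 := has_efficiency_ge0 Hmu Hnu eff1.
have e20 := has_efficiency_ge0 Hnu Ho eff2.
set h1 := entropy nu / entropy mu; set h2 := entropy o / entropy nu.
have h10 : 0 < h1 by exact: divr_gt0.
have h20 : 0 < h2 by exact: divr_gt0.
have h12 : entropy o / entropy mu = h1 * h2.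
  by rewrite /h1 /h2 [RHS]mulrC mulrA divfK// gt_eqF.
have [d [d0 d1 deps de1]] : exists d, [/\ 0 < d, d <= 1,
    d * (e1 + 2 * e2 + 2) <= eps & 0 < e1 -> 0 < e1 - 2 * d].
  have K0 : 0 < e1 + 2 * e2 + 2 by lra.
  (* The bound [e1 / 3] keeps [e1 - 2 * d] positive; for [e1 = 0] any positive value would do. *)
  pose m := if e1 == 0 then 1 else e1 / 3.
  have m0 : 0 < m.
    rewrite /m; case: eqP => // /eqP e1N0.
    by rewrite divr_gt0// lt_neqAle eq_sym e1N0.
  exists (Num.min 1 (Num.min (eps / (e1 + 2 * e2 + 2)) m)); split.
  - by rewrite !lt_min ltr01 divr_gt0.
  - by rewrite ge_min lexx.
  - by rewrite -ler_pdivlMr// !ge_min lexx orbT.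
  - move=> e1_gt0; have : Num.min 1 (Num.min (eps / (e1 + 2 * e2 + 2)) m) <= m.
      by rewrite !ge_min lexx !orbT.
    by rewrite [leRHS](_ : m = e1 / 3) => [?|]; [lra|rewrite /m gt_eqF].
(* For [e1 = 0] the lower estimate is vacuous; [lo] only has to diverge. *)
pose c := if e1 == 0 then 1 else e1 - d.
have c0 : 0 < c.
  rewrite /c; case: eqP => // /eqP e1N0.
  have : 0 < e1 by rewrite lt_neqAle eq_sym e1N0.
  by move/de1; lra.
(* The successor puts [hi n] strictly above its real target and makes it positive; [lo n] is rounded
   down. *)
pose hi n := (Num.truncn ((e1 + d) / h1 * n%:R)).+1.
pose lo n := Num.truncn (c / h1 * n%:R).
have cvg_hi : hi n @[n --> \oo] --> \oo.
  apply: (@linear_growth_cvgny _ ((e1 + d) / h1)).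
    by rewrite divr_gt0//; lra.
  move=> n; apply: ltW; apply: lt_trans (truncnS_gt _) _.
  by rewrite ltr_nat.
have cvg_lo : lo n @[n --> \oo] --> \oo.
  apply: (@linear_growth_cvgny _ (c / h1)); first by rewrite divr_gt0.
  by move=> n; rewrite ltW// truncnS_gt.
pose P1 n :=
  iid_prob mu [set alpha | d < `|eff_ratio mu nu delta1 s n alpha - e1|].
pose P2 n :=
  iid_prob nu [set beta | d < `|eff_ratio nu o delta2 t n beta - e2|].
(* Convergence in probability for [delta2] is evaluated along the deterministic diverging lengths
   [hi n] and [lo n]. *)
have cvgP : (P1 n + (P2 (hi n) + P2 (lo n)))%E @[n --> \oo] --> 0%E.
  rewrite -[X in _ --> X]adde0; apply: cvgeD => //; first exact: eff1.
  rewrite -[X in _ --> X]adde0; apply: cvgeD => //.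
    exact: (cvg_comp hi P2 cvg_hi (eff2 _ d0)).
  exact: (cvg_comp lo P2 cvg_lo (eff2 _ d0)).
apply: squeeze_cvge (cvg_cst 0%E) cvgP.
near=> n; rewrite measure_ge0 /=.
have n0 : (0 < n)%N by near: n; exact: nbhs_infty_gt.
have n0R : 0 < n%:R :> R by rewrite ltr0n.
(* Rounding by one letter costs at most [h1]; for large [n] this only widens the margin from [d] to
   [2 * d]. *)
have h1dn : h1 <= d * n%:R.
  by rewrite -ler_pdivrMl//; near: n; exact: nbhs_infty_ger.
pose Qhi x := e2 + d < (size (run delta2 t x).2)%:R / (hi n)%:R * h2.
pose Qlo x := (size (run delta2 t x).2)%:R / (lo n)%:R * h2 < e2 - d.
pose B1 := [set alpha : streamM mu |
  d < `|eff_ratio mu nu delta1 s n alpha - e1|].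
pose Bhi := [set alpha : streamM mu |
  (size (output delta1 s alpha n) <= hi n)%N /\ Qhi (output delta1 s alpha n)].
pose Blo := [set alpha : streamM mu |
  (lo n <= size (output delta1 s alpha n))%N /\ Qlo (output delta1 s alpha n)].
have mB1 : measurable B1.
  exact: (@measurable_eff_ratio R _ _ mu nu _ delta1 s n
    (fun r => d < `|r - e1|)).
have mBhi : measurable Bhi.
  exact: (@measurable_mkseq R Sigma mu (fun x =>
    (size (run delta1 s x).2 <= hi n)%N /\ Qhi (run delta1 s x).2) n).
have mBlo : measurable Blo.
  exact: (@measurable_mkseq R Sigma mu (fun x =>
    (lo n <= size (run delta1 s x).2)%N /\ Qlo (run delta1 s x).2) n).
(* Outside [B1], the deviation means that [delta2] emits too much on at most [hi n] letters or too
   little on at least [lo n] letters. *)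
apply: (@le_trans _ _ (iid_prob mu (B1 `|` (Bhi `|` Blo)))).
  apply: le_measure.
  - rewrite inE; exact: (@measurable_eff_ratio R _ _ mu o _
      (protocol_comp delta1 delta2) (s, t) n (fun r => eps < `|r - e1 * e2|)).
  - by rewrite inE; do 2?apply: measurableU.
  move=> alpha /= E.
  have [B1a|B1a] := ltP d `|eff_ratio mu nu delta1 s n alpha - e1|.
    by left.
  right; move: E B1a; rewrite /eff_ratio {1}/output run_comp.
  rewrite -/(output delta1 s alpha n) h12 -/h1 => E B1a.
  have hiE : (e1 + d) * n%:R <= (hi n)%:R * h1 <= (e1 + 2 * d) * n%:R.
    have : 0 <= (e1 + d) / h1 * n%:R.
      by rewrite mulr_ge0 ?ler0n// divr_ge0 ?(ltW h10)//; lra.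
    move=> /truncn_itv; rewrite -/(hi n) mulrAC => /andP[].
    rewrite ler_pdivlMr// ltr_pdivrMr// => l r.
    rewrite (ltW r) /= /hi -natr1 mulrDl mul1r.
    by rewrite [X in Num.truncn X]mulrAC; lra.
  have loE : 0 < e1 -> [/\ 0 < e1 - 2 * d,
      (lo n)%:R * h1 <= (e1 - d) * n%:R &
      (e1 - 2 * d) * n%:R <= (lo n)%:R * h1].
    move=> e1_gt0; have cE : c = e1 - d by rewrite /c gt_eqF.
    have : 0 <= c / h1 * n%:R.
      by rewrite mulr_ge0 ?ler0n// divr_ge0 ?(ltW h10)// ltW.
    move=> /truncn_itv; rewrite -/(lo n) -natr1 mulrAC cE => /andP[].
    rewrite ler_pdivlMr// ltr_pdivrMr// => l r; split=> //; first exact: de1.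
    by lra.
  have /andP[hi1 hi2] := hiE.
  have y0 : 0 <= (size (run delta2 t (output delta1 s alpha n)).2)%:R :> R.
    exact: ler0n.
  have hi0 : 0 < (hi n)%:R :> R by rewrite ltr0n.
  have := efficiency_window h10 h20 e10 e20 d0 d1 deps n0R h1dn y0 hi0 hi1 hi2
    loE B1a E.
  by rewrite !ler_nat => -[|]; [left|right].
apply: le_trans (measureU2 _ mB1 (measurableU _ _ mBhi mBlo)) _.
apply: leeD => //.
apply: le_trans (measureU2 _ mBhi mBlo) _.
apply: leeD.
  (* [Qhi] passes to extensions, since a longer input never shortens the output. *)
  apply: (@le_trans _ _ (iid_prob nu [set beta | Qhi (mkseq beta (hi n))])).
    apply: (@output_le_prob _ _ _ _ _ _ _ _ red1 Qhi (hi n) n) => x y xy.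
    rewrite /Qhi => /lt_le_trans; apply.
    by rewrite ler_pM2r// ler_wpM2r ?invr_ge0// ler_nat size_run_prefix.
  apply: le_measure.
  - by rewrite inE; exact: (@measurable_mkseq _ _ _ Qhi (hi n)).
  - rewrite inE; exact: (@measurable_eff_ratio R _ _ nu o _ delta2 t (hi n)
      (fun r => d < `|r - e2|)).
  move=> beta /=; rewrite /Qhi /eff_ratio -/h2 -/(output delta2 t beta (hi n)).
  by rewrite lter_normr => H; apply/orP; left; lra.
(* [Qlo] passes to prefixes, also when [lo n = 0], where the quotients are 0 by convention. *)
apply: (@le_trans _ _ (iid_prob nu [set beta | Qlo (mkseq beta (lo n))])).
  apply: (@output_ge_prob _ _ _ _ _ _ _ _ red1 Qlo (lo n) n) => x y xy.
  rewrite /Qlo; apply: le_lt_trans.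
  by rewrite ler_pM2r// ler_wpM2r ?invr_ge0// ler_nat size_run_prefix.
apply: le_measure.
- by rewrite inE; exact: (@measurable_mkseq _ _ _ Qlo (lo n)).
- rewrite inE; exact: (@measurable_eff_ratio R _ _ nu o _ delta2 t (lo n)
    (fun r => d < `|r - e2|)).
move=> beta /=; rewrite /Qlo /eff_ratio -/h2 -/(output delta2 t beta (lo n)).
by rewrite lter_normr => H; apply/orP; right; lra.
Unshelve. all: by end_near. Qed.
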